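(* Let $\mathcal{V}$ be a coherent variety of semilattice-ordered algebras (in a signature containing at least one constant symbol) that is closed under canonical extensions. Then any unary $\mathcal{V}$-expanding term $t$ that is order-preserving and decreasing in $\mathcal{V}$ (i.e. on each $\mathbf{A}\in\mathcal{V}$: $a\le b$ implies $t(a)\le t(b)$, and $t(a)\le a$) is $n$-potent in $\mathcal{V}$ for some $n\in\mathbb{N}$, i.e. $\mathcal{V}\models t^{n+1}(x)\approx t^n(x)$, where $t^0(x)=x$ and $t^{k+1}(x)=t(t^k(x))$.
   Context: Canonical extensions. A completion of a poset $P$ is a pair $\langle e,C\rangle$ where $C$ is a complete lattice and $e$ is an order embedding of $P$ into $C$ preserving all existing finite meets and joins of $P$. An element of $C$ is open (resp. closed) if it equals $\bigvee e(X)$ (resp. $\bigwedge e(X)$), taken in $C$, for some subset $X$ of $P$; $O$ and $K$ denote the sets of open and closed elements. The completion is dense if every element of $C$ is both a join of closed elements and a meet of open elements; it is compact if for any $A\subseteq K$ and $B\subseteq O$, $\bigwedge A\le\bigvee B$ if and only if there are finite subsets $A_0$ of $A$ and $B_0$ of $B$ with $\bigwedge A_0\le\bigvee B_0$. A dense and compact completion is called a canonical extension; every poset $P$ has one, unique up to a lattice isomorphism commuting with the embeddings, and it is denoted $P^\sigma$, with $P$ identified with its image. For a map $f\colon P\to Q$ between posets, the maps $f^\sigma,f^\pi\colon P^\sigma\to Q^\sigma$ are $$f^\sigma(x)=\bigvee\bigl\{\bigwedge\{f(a)\mid a\in P,\ p\le a\le q\}\mid p\in K,\ q\in O,\ p\le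 x\le q\bigr\},$$ $$f^\pi(x)=\bigwedge\bigl\{\bigvee\{f(a)\mid a\in P,\ p\le a\le q\}\mid p\in K,\ q\in O,\ p\le x\le q\bigr\},$$ where $K$ and $O$ are the sets of closed and open elements of $P^\sigma$. An $n$-ary operation on $P$ is extended by viewing it as a map $P^n\to P$ and identifying $(P^n)^\sigma$ with $(P^\sigma)^n$. A class $\mathcal{C}$ of algebras of a common signature is a class of semilattice-ordered algebras if every member has a (uniformly) term-definable semilattice reduct, which determines its poset reduct, and each operation $o$ in the signature has a canonical extension, $o^\sigma$ or $o^\pi$, determined by $\mathcal{C}$. For $\mathbf{A}\in\mathcal{C}$, $\mathbf{A}^\sigma$ denotes the universe of the canonical extension of the poset reduct of $\mathbf{A}$ equipped with the canonical extensions of the operations of $\mathbf{A}$. $\mathcal{V}$ is closed under canonical extensions if $\mathbf{A}\in\mathcal{V}$ implies $\mathbf{A}^\sigma\in\mathcal{V}$. A term $t$ is $\mathcal{V}$-expanding if $t^{\mathbf{A}^\sigma}\ge(t^{\mathbf{A}})^\sigma$ for all $\mathbf{A}\in\mathcal{V}$ (pointwise), where $t^{\mathbf{A}^\sigma}$ is the term operation evaluated in $\mathbf{A}^\sigma$ and $(t^{\mathbf{A}})^\sigma$ is the $\sigma$-extension of the map $t^{\mathbf{A}}$. $\mathcal{V}$ is coherent if every finitely generated subalgebra of a finitely presented member of $\mathcal{V}$ is finitely presented (finitely presented: isomorphic to a quotient of a finitely generated free algebra of $\mathcal{V}$ by a finitely generated congruence). *)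

(* Defs.v *)
From Stdlib Require Import Relations Ensembles Finite_sets Image.
From Stdlib Require Fin.
From Stdlib Require Import List Arith ClassicalEpsilon.
From Stdlib Require Import FunctionalExtensionality PropExtensionality
  ProofIrrelevance.

Set Implicit Arguments.

(** * Posets and complete lattices *)

Record poset := Poset {
  carrier :> Type;
  le : relation carrier;
  le_order : order carrier le }.

Arguments Poset {carrier le} _.
Arguments le {p} _ _.

Definition is_lower_bound {P : poset} (X : Ensemble P) (m : P) : Prop :=
  forall x, X x -> le m x.
Definition is_upper_bound {P : poset} (X : Ensemble P) (m : P) : Prop :=
  forall x, X x -> le x m.
Definition is_glb {P : poset} (X : Ensemble P) (m : P) : Prop :=
  is_lower_bound X m /\ forall l, is_lower_bound X l -> le l m.
Definition is_lub {P : poset} (X : Ensemble P) (m : P) : Prop :=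
  is_upper_bound X m /\ forall u, is_upper_bound X u -> le m u.


Record complete_lattice := CompleteLattice {
  cl_poset :> poset;
  Meet : Ensemble cl_poset -> cl_poset;
  Join : Ensemble cl_poset -> cl_poset;
  Meet_glb : forall X, is_glb X (Meet X);
  Join_lub : forall X, is_lub X (Join X) }.

Arguments CompleteLattice : clear implicits.
Arguments Meet {c} _.
Arguments Join {c} _.

Lemma power_order (P : poset) (n : nat) :
  order (Fin.t n -> P) (fun x y => forall i, le (x i) (y i)).
Proof.
destruct (le_order P) as [R T A]; split.
- intros x i; apply R.
- intros x y z H1 H2 i; eapply T; eauto.
- intros x y H1 H2; extensionality i; apply A; auto.
Qed.

Definition power_poset (P : poset) (n : nat) : poset :=
  Poset (power_order P n).

Definition proj_set (P : poset) (n : nat) (X : Ensemble (power_poset P n))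
  (i : Fin.t n) : Ensemble P := fun a => exists x, X x /\ a = x i.

Lemma power_Meet_glb (C : complete_lattice) (n : nat)
  (X : Ensemble (power_poset C n)) :
  @is_glb (power_poset C n) X (fun i => Meet (proj_set X i)).
Proof.
split.
- intros x Hx i; apply (Meet_glb C (proj_set X i)); exists x; auto.
- intros l Hl i; apply (Meet_glb C (proj_set X i)).
  intros a (x & Hx & ->); apply Hl; exact Hx.
Qed.

Lemma power_Join_lub (C : complete_lattice) (n : nat)
  (X : Ensemble (power_poset C n)) :
  @is_lub (power_poset C n) X (fun i => Join (proj_set X i)).
Proof.
split.
- intros x Hx i; apply (Join_lub C (proj_set X i)); exists x; auto.
- intros l Hl i; apply (Join_lub C (proj_set X i)).
  intros a (x & Hx & ->); apply Hl; exact Hx.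
Qed.

Definition power_lattice (C : complete_lattice) (n : nat) : complete_lattice :=
  CompleteLattice _ _ _ (@power_Meet_glb C n) (@power_Join_lub C n).

(** * Canonical extensions *)

Record extension (P : poset) := Extension {
  ext_lattice :> complete_lattice;
  emb : P -> ext_lattice }.

Arguments Extension {P} _ _.
Arguments emb {P} _ _.

Section Extensions.
Variables (P : poset) (C : extension P).

Definition completion : Prop :=
  (forall a b : P, le (emb C a) (emb C b) <-> le a b) /\
  (forall (X : Ensemble P) (m : P), Finite P X ->
     is_glb X m -> emb C m = Meet (Im P C X (emb C))) /\
  (forall (X : Ensemble P) (m : P), Finite P X ->
     is_lub X m -> emb C m = Join (Im P C X (emb C))).

Definition closed_elt : Ensemble C := fun k =>
  exists X : Ensemble P, k = Meet (Im P C X (emb C)).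
Definition open_elt : Ensemble C := fun o =>
  exists X : Ensemble P, o = Join (Im P C X (emb C)).

Definition dense : Prop := forall x : C,
  (exists A, Included C A closed_elt /\ x = Join A) /\
  (exists B, Included C B open_elt /\ x = Meet B).

Definition compact : Prop := forall A B : Ensemble C,
  Included C A closed_elt -> Included C B open_elt ->
  (le (Meet A) (Join B) <->
   exists A0 B0, Finite C A0 /\ Included C A0 A /\
     Finite C B0 /\ Included C B0 B /\ le (Meet A0) (Join B0)).

Definition canonical_extension : Prop := completion /\ dense /\ compact.

End Extensions.

(** The completion [C^n] of [P^n], which is how [(P^n)^sigma] is identified
    with [(P^sigma)^n].  Its closed (open) elements are the meets (joins) in
    [C^n] of subsets of [P^n]. *)
Definition power_extension (P : poset) (C : extension P) (n : nat) :
  extension (power_poset P n) :=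
  @Extension (power_poset P n) (power_lattice C n)
    (fun a i => emb C (a i)).

Section Maps.
Variables (P Q : poset) (CP : extension P) (CQ : extension Q) (f : P -> Q).

Definition interval_image (p q : CP) : Ensemble CQ := fun v =>
  exists a : P, le p (emb CP a) /\ le (emb CP a) q /\ v = emb CQ (f a).

Definition sigma_map (x : CP) : CQ := Join (fun u =>
  exists p q, closed_elt CP p /\ open_elt CP q /\ le p x /\ le x q /\
    u = Meet (interval_image p q)).

Definition pi_map (x : CP) : CQ := Meet (fun u =>
  exists p q, closed_elt CP p /\ open_elt CP q /\ le p x /\ le x q /\
    u = Join (interval_image p q)).

End Maps.

(** * Universal algebra *)

Record signature := Signature {
  symbol :> Type;
  arity : symbol -> nat }.

Arguments arity {s} _.

Definition has_constant (S : signature) : Prop := exists c : S, arity c = 0.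

Record algebra (S : signature) := Algebra {
  universe :> Type;
  op : forall o : S, (Fin.t (arity o) -> universe) -> universe }.

Arguments Algebra {S} _ _.
Arguments op {S a} _ _.

Inductive term (S : signature) (X : Type) : Type :=
| Var : X -> term S X
| App : forall o : S, (Fin.t (arity o) -> term S X) -> term S X.

Arguments Var {S X} _.
Arguments App {S X} _ _.

Definition term_algebra (S : signature) (X : Type) : algebra S :=
  Algebra (term S X) (@App S X).

Fixpoint eval (S : signature) (X : Type) (A : algebra S) (h : X -> A)
  (p : term S X) : A :=
  match p with
  | Var x => h x
  | App o ps => op o (fun i => eval A h (ps i))
  end.

Arguments eval {S X A} _ _.

Definition subst (S : signature) (X Y : Type) (h : X -> term S Y)
  (p : term S X) : term S Y := @eval S X (term_algebra S Y) h p.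

Definition homomorphism (S : signature) (A B : algebra S) (h : A -> B) : Prop :=
  forall (o : S) (a : Fin.t (arity o) -> A),
    h (op o a) = op o (fun i => h (a i)).

Definition isomorphic (S : signature) (A B : algebra S) : Prop :=
  exists (h : A -> B) (g : B -> A),
    homomorphism A B h /\ (forall a, g (h a) = a) /\ (forall b, h (g b) = b).

Inductive generated (S : signature) (A : algebra S) (G : Ensemble A) :
  Ensemble A :=
| gen_in : forall a, G a -> generated A G a
| gen_op : forall (o : S) (a : Fin.t (arity o) -> A),
    (forall i, generated A G (a i)) -> generated A G (op o a).

Definition subalgebra (S : signature) (A : algebra S) (G : Ensemble A) :
  algebra S :=
  Algebra {a : A | generated A G a}
    (fun o a => exist _ (op o (fun i => proj1_sig (a i)))
                  (gen_op o _ (fun i => proj2_sig (a i)))).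

Definition congruence (S : signature) (A : algebra S) (R : relation A) : Prop :=
  equivalence A R /\
  forall (o : S) (a b : Fin.t (arity o) -> A),
    (forall i, R (a i) (b i)) -> R (op o a) (op o b).

Definition generated_congruence (S : signature) (A : algebra S)
  (R : relation A) : relation A := fun a b =>
  forall T : relation A, congruence A T -> inclusion A R T -> T a b.

(** The elements of [A/R] are the [R]-classes; the operations act on chosen
    representatives, which is independent of the choice if [R] is a congruence. *)
Section Quotient.
Variables (S : signature) (A : algebra S) (R : relation A).

Definition quotient_carrier : Type := {C : Ensemble A | exists a, C = R a}.

Definition class (a : A) : quotient_carrier :=
  exist _ (R a) (ex_intro _ a eq_refl).

Definition repr (c : quotient_carrier) : A :=
  proj1_sig (constructive_indefinite_description _ (proj2_sig c)).

Definition quotient : algebra S :=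
  Algebra quotient_carrier (fun o c => class (op o (fun i => repr (c i)))).

End Quotient.

(** * Varieties *)

(** A variety is given by a set of equations in countably many variables. *)
Definition theory (S : signature) : Type := relation (term S nat).

Definition in_variety (S : signature) (E : theory S) (A : algebra S) : Prop :=
  forall p q, E p q -> forall h : nat -> A, eval h p = eval h q.

Definition valid (S : signature) (E : theory S) (X : Type) : relation (term S X) :=
  fun p q => forall A : algebra S, in_variety E A ->
    forall h : X -> A, eval h p = eval h q.

Arguments valid {S} E {X} _ _.

Definition free_algebra (S : signature) (E : theory S) (X : Type) : algebra S :=
  quotient (term_algebra S X) (@valid S E X).

Definition finitely_presented (S : signature) (E : theory S) (A : algebra S) :
  Prop :=
  exists (n : nat)
    (l : list (free_algebra E (Fin.t n) * free_algebra E (Fin.t n))),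
    isomorphic A
      (quotient (free_algebra E (Fin.t n))
         (generated_congruence _ (fun a b => List.In (a, b) l))).

Definition coherent (S : signature) (E : theory S) : Prop :=
  forall A : algebra S, in_variety E A -> finitely_presented E A ->
  forall G : Ensemble A, Finite A G -> finitely_presented E (subalgebra A G).

(** * Semilattice-ordered algebras *)

Record ordered_algebra (S : signature) := OrderedAlgebra {
  oa_poset :> poset;
  oa_op : forall o : S, (Fin.t (arity o) -> oa_poset) -> oa_poset }.

Arguments OrderedAlgebra {S} _ _.
Arguments oa_op {S} _ _ _.

Definition oa_algebra (S : signature) (A : ordered_algebra S) : algebra S :=
  Algebra A (oa_op A).

Coercion oa_algebra : ordered_algebra >-> algebra.

Inductive semilattice_kind := MeetSemilattice | JoinSemilattice.
Inductive extension_kind := SigmaExtension | PiExtension.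

Definition binary (S : signature) (A : algebra S) (s : term S bool) (a b : A) : A :=
  eval (fun i : bool => if i then a else b) s.

Definition unary (S : signature) (A : algebra S) (t : term S unit) (a : A) : A :=
  eval (fun _ : unit => a) t.

Record semilattice_ordered (S : signature) (E : theory S) := SemilatticeOrdered {
  sl_term : term S bool;
  sl_kind : semilattice_kind;
  sl_assoc : forall A, in_variety E A -> forall a b c,
    binary A sl_term a (binary A sl_term b c) =
    binary A sl_term (binary A sl_term a b) c;
  sl_comm : forall A, in_variety E A -> forall a b,
    binary A sl_term a b = binary A sl_term b a;
  sl_idem : forall A, in_variety E A -> forall a, binary A sl_term a a = a;
  sl_ext : S -> extension_kind }.

Definition semilattice_le (S : signature) (E : theory S)
  (L : semilattice_ordered E) (A : algebra S) (a b : A) : Prop :=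
  match sl_kind L with
  | MeetSemilattice => binary A (sl_term L) a b = a
  | JoinSemilattice => binary A (sl_term L) a b = b
  end.

(** Membership of an algebra with a specified poset reduct: the algebra is in
    the variety, and its semilattice reduct determines the poset reduct. *)
Definition in_ordered_variety (S : signature) (E : theory S)
  (L : semilattice_ordered E) (A : ordered_algebra S) : Prop :=
  in_variety E A /\ forall a b : A, le a b <-> semilattice_le L A a b.

Definition operation_extension (k : extension_kind) (P : poset)
  (C : extension P) (n : nat) (f : (Fin.t n -> P) -> P) : (Fin.t n -> C) -> C :=
  match k with
  | SigmaExtension => @sigma_map (power_poset P n) P (power_extension C n) C f
  | PiExtension => @pi_map (power_poset P n) P (power_extension C n) C f
  end.

Definition canonical_algebra (S : signature) (E : theory S)
  (L : semilattice_ordered E) (A : ordered_algebra S) (C : extension A) :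
  ordered_algebra S :=
  OrderedAlgebra C (fun o => operation_extension (sl_ext L o) C (oa_op A o)).

(** Below, [ext] is a choice of the extension [P^sigma] of each poset [P]. *)

Definition closed_under_canonical_extensions (S : signature) (E : theory S)
  (L : semilattice_ordered E) (ext : forall P : poset, extension P) : Prop :=
  forall A : ordered_algebra S, in_ordered_variety L A ->
    in_ordered_variety L (canonical_algebra L A (ext A)).

Definition expanding (S : signature) (E : theory S)
  (L : semilattice_ordered E) (ext : forall P : poset, extension P)
  (t : term S unit) : Prop :=
  forall A : ordered_algebra S, in_ordered_variety L A ->
  forall x : ext A,
    le (sigma_map (ext A) (ext A) (unary A t) x)
       (unary (canonical_algebra L A (ext A)) t x).

Definition order_preserving (S : signature) (E : theory S)
  (L : semilattice_ordered E) (t : term S unit) : Prop :=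
  forall A : ordered_algebra S, in_ordered_variety L A ->
  forall a b : A, le a b -> le (unary A t a : A) (unary A t b).

Definition decreasing (S : signature) (E : theory S)
  (L : semilattice_ordered E) (t : term S unit) : Prop :=
  forall A : ordered_algebra S, in_ordered_variety L A ->
  forall a : A, le (unary A t a : A) a.

Fixpoint term_power (S : signature) (t : term S unit) (n : nat) : term S unit :=
  match n with
  | 0 => Var tt
  | S k => subst (fun _ => term_power t k) t
  end.

Definition potent (S : signature) (E : theory S) (t : term S unit) (n : nat) :
  Prop := valid E (term_power t (n + 1)) (term_power t n).

(** * Existence of canonical extensions *)

Lemma ensemble_ext (T : Type) (A B : Ensemble T) :
  (forall x, A x <-> B x) -> A = B.
Proof. intros H; extensionality x; apply propositional_extensionality, H. Qed.

Lemma finite_singleton (T : Type) (x : T) : Finite T (Singleton T x).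
Proof.
replace (Singleton T x) with (Ensembles.Add T (Empty_set T) x).
- apply Union_is_finite; [apply Empty_is_finite | intros []].
- apply ensemble_ext; intros y; split; [intros [z []|z Hz]; exact Hz|].
  intros Hy; right; exact Hy.
Qed.

Lemma finite_union (T : Type) (A B : Ensemble T) :
  Finite T A -> Finite T B -> Finite T (Union T A B).
Proof.
intros FA FB; induction FB as [|B FB IH x Hx].
- replace (Union T A (Empty_set T)) with A; [exact FA|].
  apply ensemble_ext; intros y; split; [intros Hy; left; exact Hy|].
  intros [z Hz|z []]; exact Hz.
- assert (E : Union T A (Ensembles.Add T B x) = Ensembles.Add T (Union T A B) x).
  { apply ensemble_ext; intros y; split.
    - intros [z Hz|z [w Hw|w Hw]].
      + left; left; exact Hz.
      + left; right; exact Hw.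
      + right; exact Hw.
    - intros [z [w Hw|w Hw]|z Hz].
      + left; exact Hw.
      + right; left; exact Hw.
      + right; right; exact Hz. }
  rewrite E; destruct (classic (Union T A B x)) as [Hu|Hu].
  + replace (Ensembles.Add T (Union T A B) x) with (Union T A B); [exact IH|].
    apply ensemble_ext; intros y; split; [intros Hy; left; exact Hy|].
    intros [z Hz|z Hz]; [exact Hz | destruct Hz; exact Hu].
  + apply Union_is_finite; [exact IH | exact Hu].
Qed.

(** [P^sigma] as the concept lattice of the relation "some finite part of [X]
    has its meet below the join of some finite part of [Y]", the meet and join
    being computed in the MacNeille completion of [P]. *)
Section Existence.
Variable P : poset.

Let lerefl : forall a : P, le a a := ord_refl _ _ (le_order P).
Let letrans : forall a b c : P, le a b -> le b c -> le a c :=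
  ord_trans _ _ (le_order P).

Definition finitely_below (X Y : Ensemble P) : Prop :=
  exists X0 Y0, Finite P X0 /\ Finite P Y0 /\ Included P X0 X /\
    Included P Y0 Y /\
    forall l u, is_lower_bound X0 l -> is_upper_bound Y0 u -> le l u.

Lemma fb_mono X X' Y Y' : Included P X X' -> Included P Y Y' ->
  finitely_below X Y -> finitely_below X' Y'.
Proof.
intros HX HY (X0 & Y0 & F1 & F2 & I1 & I2 & H); exists X0, Y0.
repeat split; auto; intros a Ha; [apply HX, I1 | apply HY, I2]; exact Ha.
Qed.

Lemma fb_finite X Y : Finite P X -> Finite P Y ->
  (forall l u, is_lower_bound X l -> is_upper_bound Y u -> le l u) ->
  finitely_below X Y.
Proof. intros F1 F2 H; exists X, Y; repeat split; auto; intros a Ha; exact Ha. Qed.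

Lemma fb_cut X Y Z : (forall x, X x -> finitely_below Z (Singleton P x)) ->
  finitely_below X Y -> finitely_below Z Y.
Proof.
intros HZ (X0 & Y0 & F1 & F2 & I1 & I2 & H).
assert (E : exists Z0, Finite P Z0 /\ Included P Z0 Z /\
          forall l, is_lower_bound Z0 l -> is_lower_bound X0 l).
{ clear H; induction F1 as [|A FA IH x Hx].
  - exists (Empty_set P); split; [apply Empty_is_finite|]; split.
    + intros a Ha; destruct Ha.
    + intros a _ b Hb; destruct Hb.
  - destruct IH as (Z0 & F & I & HL).
    { intros a Ha; apply I1; left; exact Ha. }
    destruct (HZ x) as (Z1 & Y1 & F3 & F4 & I3 & I4 & H1).
    { apply I1; right; constructor. }
    exists (Union P Z0 Z1); split; [apply finite_union; auto|]; split.
    + intros a [b Hb|b Hb]; [apply I | apply I3]; exact Hb.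
    + intros l Hl a [b Hb|b Hb].
      * apply HL; [intros c Hc; apply Hl; left; exact Hc | exact Hb].
      * destruct Hb; apply H1; [intros c Hc; apply Hl; right; exact Hc|].
        intros c Hc; destruct (I4 c Hc); apply lerefl. }
destruct E as (Z0 & F & I & HL); exists Z0, Y0; repeat split; auto.
Qed.

Lemma fb_cocut X Y Z : (forall y, Y y -> finitely_below (Singleton P y) Z) ->
  finitely_below X Y -> finitely_below X Z.
Proof.
intros HZ (X0 & Y0 & F1 & F2 & I1 & I2 & H).
assert (E : exists Z0, Finite P Z0 /\ Included P Z0 Z /\
          forall u, is_upper_bound Z0 u -> is_upper_bound Y0 u).
{ clear H; induction F2 as [|A FA IH x Hx].
  - exists (Empty_set P); split; [apply Empty_is_finite|]; split.
    + intros a Ha; destruct Ha.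
    + intros a _ b Hb; destruct Hb.
  - destruct IH as (Z0 & F & I & HL).
    { intros a Ha; apply I2; left; exact Ha. }
    destruct (HZ x) as (X1 & Z1 & F3 & F4 & I3 & I4 & H1).
    { apply I2; right; constructor. }
    exists (Union P Z0 Z1); split; [apply finite_union; auto|]; split.
    + intros a [b Hb|b Hb]; [apply I | apply I4]; exact Hb.
    + intros l Hl a [b Hb|b Hb].
      * apply HL; [intros c Hc; apply Hl; left; exact Hc | exact Hb].
      * destruct Hb; apply H1; [|intros c Hc; apply Hl; right; exact Hc].
        intros c Hc; destruct (I3 c Hc); apply lerefl. }
destruct E as (Z0 & F & I & HL); exists X0, Z0; repeat split; auto.
Qed.

Lemma fb_singletons a b :
  finitely_below (Singleton P a) (Singleton P b) <-> le a b.
Proof.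
split.
- intros (X0 & Y0 & _ & _ & I1 & I2 & H); apply H.
  + intros c Hc; destruct (I1 c Hc); apply lerefl.
  + intros c Hc; destruct (I2 c Hc); apply lerefl.
- intros Hab; apply fb_finite; try apply finite_singleton.
  intros l u Hl Hu; apply letrans with a; [apply Hl; constructor|].
  apply letrans with b; [exact Hab | apply Hu; constructor].
Qed.

Lemma fb_member X x : X x -> finitely_below X (Singleton P x).
Proof.
intros Hx; apply fb_mono with (Singleton P x) (Singleton P x).
- intros a Ha; destruct Ha; exact Hx.
- intros a Ha; exact Ha.
- apply fb_singletons, lerefl.
Qed.

Lemma fb_comember Y y : Y y -> finitely_below (Singleton P y) Y.
Proof.
intros Hy; apply fb_mono with (Singleton P y) (Singleton P y).
- intros a Ha; exact Ha.
- intros a Ha; destruct Ha; exact Hy.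
- apply fb_singletons, lerefl.
Qed.

Definition upper (U : Ensemble (Ensemble P)) : Ensemble (Ensemble P) :=
  fun Y => forall X, U X -> finitely_below X Y.
Definition lower (W : Ensemble (Ensemble P)) : Ensemble (Ensemble P) :=
  fun X => forall Y, W Y -> finitely_below X Y.

Definition concept : Type :=
  {U : Ensemble (Ensemble P) | forall X, lower (upper U) X -> U X}.

Definition concept_le (U V : concept) : Prop :=
  forall X, proj1_sig U X -> proj1_sig V X.

Lemma concept_order : order concept concept_le.
Proof.
split.
- intros U X HX; exact HX.
- intros U V W H1 H2 X HX; apply H2, H1, HX.
- intros [U HU] [V HV] H1 H2.
  assert (E : U = V).
  { extensionality X; apply propositional_extensionality; split; [apply H1|apply H2]. }
  destruct E; f_equal; apply proof_irrelevance.
Qed.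

Definition concept_poset : poset := Poset concept_order.

Lemma lower_closed W X : lower (upper (lower W)) X -> lower W X.
Proof. intros H Y HY; apply H; intros Z HZ; apply HZ, HY. Qed.

Definition lower_concept (W : Ensemble (Ensemble P)) : concept_poset :=
  exist _ (lower W) (@lower_closed W).

Lemma inter_closed (F : Ensemble concept_poset) (X : Ensemble P) :
  lower (upper (fun Z => forall U, F U -> proj1_sig U Z)) X ->
  forall U, F U -> proj1_sig U X.
Proof.
intros H U HU; apply (proj2_sig U); intros Y HY; apply H.
intros Z HZ; apply HY, HZ, HU.
Qed.

Definition concept_Meet (F : Ensemble concept_poset) : concept_poset :=
  exist _ _ (inter_closed F).

Definition concept_Join (F : Ensemble concept_poset) : concept_poset :=
  lower_concept (upper (fun Z => exists U, F U /\ proj1_sig U Z)).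

Lemma concept_Meet_glb F : is_glb F (concept_Meet F).
Proof.
split.
- intros U HU X HX; apply HX, HU.
- intros L HL X HX U HU; apply (HL U HU), HX.
Qed.

Lemma concept_Join_lub F : is_lub F (concept_Join F).
Proof.
split.
- intros U HU X HX Y HY; apply HY; exists U; auto.
- intros V HV X HX; apply (proj2_sig V); intros Y HY; apply HX.
  intros Z (U & HU & HZ); apply HY, (HV U HU), HZ.
Qed.

Definition concept_lattice : complete_lattice :=
  CompleteLattice _ _ _ concept_Meet_glb concept_Join_lub.

Definition concept_extension : extension P :=
  Extension concept_lattice
    (fun a => lower_concept (Singleton _ (Singleton P a))).

Notation C := concept_extension.

Lemma emb_in a X : proj1_sig (emb C a) X <-> finitely_below X (Singleton P a).
Proof.
split; [intros H; apply H; constructor | intros H Y HY; destruct HY; exact H].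
Qed.

Lemma Meet_in (X Z : Ensemble P) :
  proj1_sig (Meet (Im P C X (emb C)) : concept_poset) Z <->
  forall x, X x -> finitely_below Z (Singleton P x).
Proof.
split.
- intros H x Hx; apply emb_in, H; apply Im_intro with x; auto.
- intros H U HU; destruct HU as [x Hx U ->]; apply emb_in, H, Hx.
Qed.

Lemma Join_in (Y Z : Ensemble P) :
  proj1_sig (Join (Im P C Y (emb C)) : concept_poset) Z <-> finitely_below Z Y.
Proof.
split.
- intros H; apply H; intros X (U & HU & HX); destruct HU as [y Hy U ->].
  apply emb_in in HX; apply fb_cut with (Singleton P y).
  + intros a Ha; destruct Ha; exact HX.
  + apply fb_comember, Hy.
- intros H W HW; apply fb_cocut with Y; [|exact H].
  intros y Hy; apply HW; exists (emb C y); split; [apply Im_intro with y; auto|].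
  apply emb_in, fb_singletons, lerefl.
Qed.

Lemma concept_eq (U V : C) :
  (forall X, proj1_sig U X <-> proj1_sig V X) -> U = V.
Proof.
intros H; apply (ord_antisym _ _ concept_order); intros X HX; apply H, HX.
Qed.

Lemma concept_completion : completion C.
Proof.
repeat split.
- intros H; apply fb_singletons, emb_in, H, emb_in, fb_singletons, lerefl.
- intros H X HX; apply emb_in in HX; apply emb_in.
  apply fb_cocut with (Singleton P a); [|exact HX].
  intros y Hy; destruct Hy; apply fb_singletons, H.
- intros X m F [Hm Hg]; apply concept_eq; intros Z; split.
  + intros HZ; apply Meet_in; intros x Hx; apply emb_in in HZ.
    apply fb_cocut with (Singleton P m); [|exact HZ].
    intros y Hy; destruct Hy; apply fb_singletons, Hm, Hx.
  + intros HZ; apply emb_in, fb_cut with X; [apply Meet_in, HZ|].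
    apply fb_finite; [exact F | apply finite_singleton |].
    intros l u Hl Hu; apply letrans with m; [apply Hg, Hl | apply Hu; constructor].
- intros X m F [Hm Hl]; apply concept_eq; intros Z; split.
  + intros HZ; apply Join_in, fb_cut with (Singleton P m).
    * intros x Hx; destruct Hx; apply emb_in, HZ.
    * apply fb_finite; [apply finite_singleton | exact F |].
      intros l u H1 H2; apply letrans with m; [apply H1; constructor | apply Hl, H2].
  + intros HZ; apply emb_in, fb_cocut with X; [|apply Join_in, HZ].
    intros y Hy; apply fb_singletons, Hm, Hy.
Qed.

Lemma concept_dense : dense C.
Proof.
intros U; split.
- exists (fun k => exists X, proj1_sig U X /\ k = Meet (Im P C X (emb C))); split.
  + intros k (X & _ & ->); exists X; reflexivity.
  + apply concept_eq; intros X; split.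
    * intros HX.
      apply (proj1 (concept_Join_lub _) (Meet (Im P C X (emb C)))).
      -- exists X; auto.
      -- apply Meet_in; intros x Hx; apply fb_member, Hx.
    * revert X; apply (proj2 (concept_Join_lub _)); intros k (X & HX & ->) Z HZ.
      apply (proj2_sig U); intros Y HY; apply fb_cut with X.
      -- apply Meet_in, HZ.
      -- apply HY, HX.
- exists (fun o => exists Y, upper (proj1_sig U) Y /\ o = Join (Im P C Y (emb C))).
  split.
  + intros k (X & _ & ->); exists X; reflexivity.
  + apply concept_eq; intros X; split.
    * intros HX V (Y & HY & ->); apply Join_in, HY, HX.
    * intros HX; apply (proj2_sig U); intros Y HY; apply Join_in, HX.
      exists Y; auto.
Qed.

Lemma lattice_le_trans (D : complete_lattice) (x y z : D) :
  le x y -> le y z -> le x z.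
Proof. apply (ord_trans _ _ (le_order D)). Qed.

Lemma Meet_anti (D : complete_lattice) (A B : Ensemble D) :
  Included D A B -> le (Meet B) (Meet A).
Proof.
intros H; apply (Meet_glb D A); intros x Hx; apply (Meet_glb D B), H, Hx.
Qed.

Lemma Join_mono (D : complete_lattice) (A B : Ensemble D) :
  Included D A B -> le (Join A) (Join B).
Proof.
intros H; apply (Join_lub D A); intros x Hx; apply (Join_lub D B), H, Hx.
Qed.

Lemma finite_below (A : Ensemble C) (X : Ensemble P) : Finite P X ->
  (forall x, X x -> exists k, A k /\ le k (emb C x)) ->
  exists A0, Finite C A0 /\ Included C A0 A /\
    le (Meet A0) (Meet (Im P C X (emb C))).
Proof.
intros F; induction F as [|X F IH x Hx]; intros H.
- exists (Empty_set C); split; [apply Empty_is_finite|]; split.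
  + intros k Hk; destruct Hk.
  + apply Meet_glb; intros k Hk; destruct Hk as [x []].
- destruct IH as (A0 & F0 & I0 & H0); [intros; apply H; left; assumption|].
  destruct (H x) as (k & Hk & Hkx); [right; constructor|].
  exists (Union C A0 (Singleton C k)); split.
  { apply finite_union; [exact F0 | apply finite_singleton]. }
  split.
  { intros a [b Hb|b Hb]; [apply I0, Hb | destruct Hb; exact Hk]. }
  apply Meet_glb; intros a Ha; destruct Ha as [y [z Hz|z Hz] a ->].
  + eapply lattice_le_trans; [apply Meet_anti with (A := A0)|].
    { intros b Hb; left; exact Hb. }
    eapply lattice_le_trans; [exact H0|].
    apply Meet_glb, Im_intro with z; auto.
  + destruct Hz; eapply lattice_le_trans; [|exact Hkx].
    apply Meet_glb; right; constructor.
Qed.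

Lemma finite_above (B : Ensemble C) (Y : Ensemble P) : Finite P Y ->
  (forall y, Y y -> exists o, B o /\ le (emb C y) o) ->
  exists B0, Finite C B0 /\ Included C B0 B /\
    le (Join (Im P C Y (emb C))) (Join B0).
Proof.
intros F; induction F as [|X F IH x Hx]; intros H.
- exists (Empty_set C); split; [apply Empty_is_finite|]; split.
  + intros k Hk; destruct Hk.
  + apply Join_lub; intros k Hk; destruct Hk as [x []].
- destruct IH as (A0 & F0 & I0 & H0); [intros; apply H; left; assumption|].
  destruct (H x) as (k & Hk & Hkx); [right; constructor|].
  exists (Union C A0 (Singleton C k)); split.
  { apply finite_union; [exact F0 | apply finite_singleton]. }
  split.
  { intros a [b Hb|b Hb]; [apply I0, Hb | destruct Hb; exact Hk]. }
  apply Join_lub; intros a Ha; destruct Ha as [y [z Hz|z Hz] a ->].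
  + eapply lattice_le_trans; [|apply Join_mono with (A := A0)].
    2: { intros b Hb; left; exact Hb. }
    eapply lattice_le_trans; [|exact H0].
    apply Join_lub, Im_intro with z; auto.
  + destruct Hz; eapply lattice_le_trans; [exact Hkx|].
    apply Join_lub; right; constructor.
Qed.

Lemma concept_compact : compact C.
Proof.
intros A B HA HB; split.
- intros H.
  set (X := fun x => exists k, A k /\ le k (emb C x)).
  set (Y := fun y => exists o, B o /\ le (emb C y) o).
  assert (HXY : finitely_below X Y).
  { assert (HX : proj1_sig (Join B : concept_poset) X).
    { apply H; intros k Hk; destruct (HA k Hk) as (X' & E); subst k.
      apply Meet_in; intros x Hx; apply fb_member.
      exists (Meet (Im P C X' (emb C))); split; [exact Hk|].
      apply Meet_glb, Im_intro with x; auto. }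
    apply HX; intros Z (o & Ho & HZ).
    destruct (HB o Ho) as (Y' & E); subst o; apply Join_in in HZ.
    apply fb_mono with Z Y'; [intros a Ha; exact Ha | | exact HZ].
    intros y Hy; exists (Join (Im P C Y' (emb C))); split; [exact Ho|].
    apply Join_lub, Im_intro with y; auto. }
  destruct HXY as (X0 & Y0 & F1 & F2 & I1 & I2 & H0).
  destruct (finite_below A F1 I1) as (A0 & FA & IA & LA).
  destruct (finite_above B F2 I2) as (B0 & FB & IB & LB).
  exists A0, B0; repeat (split; [assumption|]).
  eapply lattice_le_trans; [exact LA|].
  eapply lattice_le_trans; [|exact LB].
  intros Z HZ; apply Join_in, fb_cut with X0; [apply Meet_in, HZ|].
  apply fb_finite; auto.
- intros (A0 & B0 & _ & IA & _ & IB & H).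
  eapply lattice_le_trans; [apply Meet_anti, IA|].
  eapply lattice_le_trans; [exact H | apply Join_mono, IB].
Qed.

Theorem canonical_extension_exists : exists C : extension P, canonical_extension C.
Proof.
exists concept_extension.
split; [exact concept_completion|]; split; [exact concept_dense|exact concept_compact].
Qed.

End Existence.

Corollary canonical_extensions_exist :
  exists ext : forall P : poset, extension P,
    forall P : poset, canonical_extension (ext P).
Proof.
exists (fun P => proj1_sig
  (constructive_indefinite_description _ (canonical_extension_exists P))).
intros P; apply proj2_sig.
Qed.

(* Main.v *)
(** Consider the algebra presented by generators x, y, z and relations
    y <= x, t(x) = x, x <= z.  An equation in y and z holds in it only if it
    follows from the inequalities y <= t^k(z), k in N: if d <= t^k(e) for all k
    in an algebra D, then x can be interpreted in D^sigma as the meet of the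
    t^k(e), which is a fixpoint of t by compactness and because t is expanding.
    By coherence the subalgebra generated by y and z is finitely presented, so
    that finitely many of these inequalities, hence a single y <= t^n(z), imply
    y <= t^(n+1)(z).  Take y = t^n(z). *)

From Stdlib Require Import Relations Ensembles Finite_sets Image.
From Stdlib Require Fin.
From Stdlib Require Import List Arith Lia ClassicalEpsilon.
From Stdlib Require Import FunctionalExtensionality ProofIrrelevance.
Require Import Defs.

Set Implicit Arguments.

(** The maximum of finitely many witnesses works. With finite arities, this makes the union of a
    chain of congruences compatible with the operations. *)
Lemma fin_uniform_bound (m : nat) (Q : Fin.t m -> nat -> Prop) :
  (forall i j k, j <= k -> Q i j -> Q i k) -> (forall i, exists k, Q i k) ->
  exists k, forall i, Q i k.
Proof.
revert Q; induction m as [|m IH]; intros Q Qm HQ.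
- exists 0; intros i; inversion i.
- destruct (IH (fun i => Q (Fin.FS i))) as (k & Hk); [intros i; apply Qm|auto|].
  destruct (HQ Fin.F1) as (j & Hj).
  exists (max j k); intros i; apply (Fin.caseS' i).
  + apply Qm with j; [lia | exact Hj].
  + intros i'; apply Qm with k; [lia | apply Hk].
Qed.

(** * Homomorphisms and quotients *)

Section Algebras.
Variable S : signature.

Lemma hom_eval (A B : algebra S) (f : A -> B) (X : Type) (h : X -> A)
  (p : term S X) :
  homomorphism A B f -> f (eval h p) = eval (fun x => f (h x)) p.
Proof.
intros Hf; induction p as [x|o ps IH]; simpl; [reflexivity|].
rewrite Hf; f_equal; extensionality i; apply IH.
Qed.

Lemma eval_hom (A : algebra S) (X : Type) (h : X -> A) :
  homomorphism (term_algebra S X) A (eval h).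
Proof. intros o a; reflexivity. Qed.

Lemma eval_subst (A : algebra S) (X Y : Type) (h : Y -> A)
  (g : X -> term S Y) (p : term S X) :
  eval h (subst g p) = eval (fun x => eval h (g x)) p.
Proof. exact (hom_eval (A := term_algebra S Y) g p (eval_hom _ h)). Qed.

Lemma hom_comp (A B C : algebra S) (f : A -> B) (g : B -> C) :
  homomorphism A B f -> homomorphism B C g ->
  homomorphism A C (fun a => g (f a)).
Proof. intros Hf Hg o a; rewrite Hf, Hg; reflexivity. Qed.

Lemma hom_inverse (A B : algebra S) (f : A -> B) (g : B -> A) :
  homomorphism A B f -> (forall a, g (f a) = a) -> (forall b, f (g b) = b) ->
  homomorphism B A g.
Proof.
intros Hf gf fg o b.
replace b with (fun i => f (g (b i))) at 1 by (extensionality i; apply fg).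
rewrite <- Hf; apply gf.
Qed.

Lemma hom_binary (A B : algebra S) (f : A -> B) (s : term S bool) (a b : A) :
  homomorphism A B f -> f (binary A s a b) = binary B s (f a) (f b).
Proof.
intros Hf; unfold binary; rewrite (hom_eval _ _ Hf).
f_equal; extensionality i; destruct i; reflexivity.
Qed.

Lemma hom_unary (A B : algebra S) (f : A -> B) (t : term S unit) (a : A) :
  homomorphism A B f -> f (unary A t a) = unary B t (f a).
Proof. intros Hf; apply (hom_eval _ _ Hf). Qed.

Lemma unary_power_S (A : algebra S) (t : term S unit) (k : nat) (a : A) :
  unary A (term_power t (Datatypes.S k)) a =
  unary A t (unary A (term_power t k) a).
Proof. apply eval_subst. Qed.

Lemma proj1_sig_hom (A : algebra S) (G : Ensemble A) :
  homomorphism (subalgebra A G) A (@proj1_sig A (generated A G)).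
Proof. intros o a; reflexivity. Qed.

(** Induction on generation builds the term; the variables [true] and [false] stand for [y] and
    [z]. *)
Lemma generated_pair (A : algebra S) (y z a : A) :
  generated A (fun b => b = y \/ b = z) a ->
  exists p : term S bool, eval (fun i : bool => if i then y else z) p = a.
Proof.
intros H; induction H as [a [->| ->]|o a _ IH].
- exists (Var true); reflexivity.
- exists (Var false); reflexivity.
- exists (App o (fun i =>
    proj1_sig (constructive_indefinite_description _ (IH i)))); simpl.
  f_equal; extensionality i.
  exact (proj2_sig (constructive_indefinite_description _ (IH i))).
Qed.

Lemma kernel_congruence (A B : algebra S) (f : A -> B) :
  homomorphism A B f -> congruence A (fun a b => f a = f b).
Proof.
intros Hf; split; [split; congruence|].
intros o a b H; rewrite !Hf; f_equal; extensionality i; apply H.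
Qed.

Lemma generated_congruence_congruence (A : algebra S) (R : relation A) :
  congruence A (generated_congruence A R).
Proof.
split; [split|].
- intros a T HT _; apply HT.
- intros a b c H1 H2 T HT HR.
  apply (equiv_trans _ _ (proj1 HT)) with b; [apply H1 | apply H2]; assumption.
- intros a b H T HT HR; apply (equiv_sym _ _ (proj1 HT)), H; assumption.
- intros o a b H T HT HR; apply HT; intros i; apply H; assumption.
Qed.

Lemma generated_congruence_incl (A : algebra S) (R : relation A) (a b : A) :
  R a b -> generated_congruence A R a b.
Proof. intros H T _ HR; apply HR, H. Qed.

(** * Homomorphisms out of a quotient, and evaluation in it *)

Section Quotients.
Variables (A : algebra S) (R : relation A).
Hypothesis HR : congruence A R.

Lemma class_eq (a b : A) : class A R a = class A R b <-> R a b.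
Proof.
destruct HR as [[Re Tr Sy] _]; split.
(* The class of [a] equals that of [b], which contains [b] by reflexivity. *)
- intros H; change (proj1_sig (class A R a) b); rewrite H; apply Re.
- intros H.
  assert (E : R a = R b).
  { apply ensemble_ext; intros c; split; intros Hc;
      [apply Tr with a | apply Tr with b]; auto. }
  unfold class; apply eq_sig_hprop; [intros; apply proof_irrelevance | exact E].
Qed.

Lemma repr_class (a : A) : R a (repr (class A R a)).
Proof.
unfold repr; destruct (constructive_indefinite_description _ _) as [b E]; simpl in *.
rewrite E; apply HR.
Qed.

Lemma class_repr (c : quotient A R) : class A R (repr c) = c.
Proof.
unfold repr; destruct (constructive_indefinite_description _ _) as [b E]; simpl.
destruct c as [C HC]; simpl in E; subst C.
unfold class; f_equal; apply proof_irrelevance.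
Qed.

Lemma class_hom : homomorphism A (quotient A R) (class A R).
Proof.
intros o a; apply class_eq, HR; intros i; apply repr_class.
Qed.

Lemma quotient_lift (B : algebra S) (f : A -> B) :
  homomorphism A B f -> (forall a b, R a b -> f a = f b) ->
  exists g : quotient A R -> B,
    homomorphism (quotient A R) B g /\ forall a, g (class A R a) = f a.
Proof.
intros Hf H; exists (fun c => f (repr c)).
assert (E : forall a, f (repr (class A R a)) = f a)
  by (intros a; symmetry; apply H, repr_class).
split; [|exact E].
intros o a; simpl; rewrite E; apply Hf.
Qed.

Lemma eval_quotient (X : Type) (h : X -> quotient A R) (p : term S X) :
  eval h p = class A R (eval (fun x => repr (h x)) p).
Proof.
rewrite (hom_eval _ _ class_hom); f_equal.
extensionality x; symmetry; apply class_repr.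
Qed.

End Quotients.

(** * Membership in the variety, and algebras given by generators and relations *)

Variable E : theory S.

Lemma quotient_in_variety (A : algebra S) (R : relation A) :
  congruence A R -> in_variety E A -> in_variety E (quotient A R).
Proof.
intros HR HA p q Hpq h; rewrite !(eval_quotient HR); f_equal; apply HA, Hpq.
Qed.

(** A valuation in the quotient comes from a substitution of representatives, so substitution
    instances of the axioms are all that has to be checked. *)
Lemma term_quotient_in_variety (X : Type) (R : relation (term_algebra S X)) :
  congruence (term_algebra S X) R ->
  (forall p q (g : nat -> term S X), E p q -> R (subst g p) (subst g q)) ->
  in_variety E (quotient (term_algebra S X) R).
Proof.
intros HR H p q Hpq h; rewrite !(eval_quotient HR).
apply (class_eq HR), H, Hpq.
Qed.

Lemma valid_congruence (X : Type) :
  congruence (term_algebra S X) (@valid S E X).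
Proof.
split; [split|].
- intros p A HA h; reflexivity.
- intros p q r H1 H2 A HA h; rewrite H1 by exact HA; apply H2, HA.
- intros p q H A HA h; symmetry; apply H, HA.
- intros o a b H A HA h; simpl; f_equal; extensionality i; apply H, HA.
Qed.

Lemma free_in_variety (X : Type) : in_variety E (free_algebra E X).
Proof.
apply term_quotient_in_variety; [apply valid_congruence|].
intros p q g Hpq A HA h; rewrite !eval_subst; apply HA, Hpq.
Qed.

Definition free_class (X : Type) (p : term S X) : free_algebra E X :=
  class (term_algebra S X) (@valid S E X) p.

Definition presented (X : Type) (R : relation (free_algebra E X)) : algebra S :=
  quotient (free_algebra E X) (generated_congruence (free_algebra E X) R).

Definition presented_class (X : Type) (R : relation (free_algebra E X))
  (p : term S X) : presented R :=
  class (free_algebra E X) (generated_congruence (free_algebra E X) R)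
    (free_class p).

Lemma presented_in_variety (X : Type) (R : relation (free_algebra E X)) :
  in_variety E (presented R).
Proof.
apply quotient_in_variety;
  [apply generated_congruence_congruence | apply free_in_variety].
Qed.

Lemma presented_class_hom (X : Type) (R : relation (free_algebra E X)) :
  homomorphism (term_algebra S X) (presented R) (presented_class R).
Proof.
exact (hom_comp (class_hom (valid_congruence X))
  (class_hom (generated_congruence_congruence _ R))).
Qed.

Lemma presented_class_surjective (X : Type) (R : relation (free_algebra E X))
  (a : presented R) : exists p, presented_class R p = a.
Proof.
exists (repr (repr a)); unfold presented_class, free_class.
rewrite class_repr; apply class_repr.
Qed.

Lemma presented_class_eq (X : Type) (R : relation (free_algebra E X)) p q :
  R (free_class p) (free_class q) -> presented_class R p = presented_class R q.
Proof.
intros H; apply (class_eq (generated_congruence_congruence _ R)).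
apply generated_congruence_incl, H.
Qed.

(** The universal property of a presentation: [eval h] factors first through the free algebra, then
    through the congruence generated by [R]. *)
Lemma presented_lift (X : Type) (R : relation (free_algebra E X))
  (D : algebra S) (h : X -> D) :
  in_variety E D ->
  (forall a b, R a b -> exists p q,
     a = free_class p /\ b = free_class q /\ eval h p = eval h q) ->
  exists f : presented R -> D, homomorphism (presented R) D f /\
    forall p, f (presented_class R p) = eval h p.
Proof.
intros HD H.
destruct (quotient_lift (valid_congruence X) (eval_hom _ h))
  as (f & Hf & Ef).
{ intros p q Hpq; apply Hpq, HD. }
destruct (quotient_lift (generated_congruence_congruence _ R) Hf)
  as (g & Hg & Eg).
(* The kernel of [f] is a congruence containing [R], so it contains the one generated by [R]. *)
{ intros a b Hab; apply (Hab _ (kernel_congruence Hf)).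
  intros c d Hcd; destruct (H c d Hcd) as (p & q & -> & -> & Epq).
  unfold free_class; rewrite !Ef; exact Epq. }
exists g; split; [exact Hg|].
intros p; unfold presented_class; rewrite Eg; apply Ef.
Qed.

End Algebras.

(** * Canonical extensions *)

Lemma poset_refl (P : poset) (a : P) : le a a.
Proof. apply (ord_refl _ _ (le_order P)). Qed.

Lemma poset_trans (P : poset) (a b c : P) : le a b -> le b c -> le a c.
Proof. apply (ord_trans _ _ (le_order P)). Qed.

Lemma poset_antisym (P : poset) (a b : P) : le a b -> le b a -> a = b.
Proof. apply (ord_antisym _ _ (le_order P)). Qed.

(** * Extended operations restrict to the original ones *)

Section Embedding.
Variables (P : poset) (C : extension P).
Hypothesis emb_le : forall a b : P, le (emb C a) (emb C b) <-> le a b.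

Lemma emb_injective (a b : P) : emb C a = emb C b -> a = b.
Proof.
intros H; apply poset_antisym; apply emb_le; rewrite H; apply poset_refl.
Qed.

Lemma emb_power_closed (n : nat) (a : power_poset P n) :
  closed_elt (power_extension C n) (fun i => emb C (a i)).
Proof.
exists (Singleton _ a).
apply (@poset_antisym (power_lattice C n)).
- apply (Meet_glb (power_lattice C n)).
  intros x [b Hb y ->]; destruct Hb; apply poset_refl.
- apply (Meet_glb (power_lattice C n)).
  apply Im_intro with a; [constructor | reflexivity].
Qed.

Lemma emb_power_open (n : nat) (a : power_poset P n) :
  open_elt (power_extension C n) (fun i => emb C (a i)).
Proof.
exists (Singleton _ a).
apply (@poset_antisym (power_lattice C n)).
- apply (Join_lub (power_lattice C n)).
  apply Im_intro with a; [constructor | reflexivity].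
- apply (Join_lub (power_lattice C n)).
  intros x [b Hb y ->]; destruct Hb; apply poset_refl.
Qed.

Lemma emb_power_interval (n : nat) (f : (Fin.t n -> P) -> P)
  (a : power_poset P n) (v : C) :
  @interval_image (power_poset P n) P (power_extension C n) C f
    (fun i => emb C (a i)) (fun i => emb C (a i)) v -> v = emb C (f a).
Proof.
intros (b & H1 & H2 & ->).
replace b with a; [reflexivity|].
extensionality i; apply poset_antisym; apply emb_le; [apply H1 | apply H2].
Qed.

(** A tuple from [P] is both closed and open in the power, so the interval from it to itself is
    admissible and contains this tuple alone; every other admissible interval contains it too. *)
Lemma operation_extension_emb (k : extension_kind) (n : nat)
  (f : (Fin.t n -> P) -> P) (a : Fin.t n -> P) :
  operation_extension k C f (fun i => emb C (a i)) = emb C (f a).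
Proof.
destruct k; simpl; unfold sigma_map, pi_map; apply poset_antisym.
- apply (Join_lub C); intros u (p & q & _ & _ & Hp & Hq & ->).
  apply (Meet_glb C); exists a; auto.
- eapply poset_trans; [|apply (proj1 (Join_lub C _))].
  2: { exists (fun i => emb C (a i)), (fun i => emb C (a i)).
       split; [apply emb_power_closed|]; split; [apply emb_power_open|].
       split; [apply poset_refl|]; split; [apply poset_refl | reflexivity]. }
  apply (Meet_glb C); intros v Hv.
  rewrite (emb_power_interval _ Hv); apply poset_refl.
- eapply poset_trans; [apply (proj1 (Meet_glb C _))|].
  { exists (fun i => emb C (a i)), (fun i => emb C (a i)).
    split; [apply emb_power_closed|]; split; [apply emb_power_open|].
    split; [apply poset_refl|]; split; [apply poset_refl | reflexivity]. }
  apply (Join_lub C); intros v Hv.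
  rewrite (emb_power_interval _ Hv); apply poset_refl.
- apply (Meet_glb C); intros u (p & q & _ & _ & Hp & Hq & ->).
  apply (Join_lub C); exists a; auto.
Qed.

End Embedding.

Lemma emb_closed (P : poset) (C : extension P) (a : P) :
  closed_elt C (emb C a).
Proof.
exists (Singleton _ a); apply poset_antisym.
- apply (Meet_glb C); intros x [b Hb y ->]; destruct Hb; apply poset_refl.
- apply (Meet_glb C), Im_intro with a; [constructor | reflexivity].
Qed.

Lemma emb_open (P : poset) (C : extension P) (a : P) : open_elt C (emb C a).
Proof.
exists (Singleton _ a); apply poset_antisym.
- apply (Join_lub C), Im_intro with a; [constructor | reflexivity].
- apply (Join_lub C); intros x [b Hb y ->]; destruct Hb; apply poset_refl.
Qed.

(** * Meets of decreasing sequences in a canonical extension *)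

Section Chains.
Variables (P : poset) (C : extension P).
Hypothesis HC : canonical_extension C.
Variable c : nat -> P.
Hypothesis c_decreasing : forall k, le (c (S k)) (c k).

Let chain_meet : C := Meet (fun v => exists k, v = emb C (c k)).

Lemma chain_le (j k : nat) : j <= k -> le (c k) (c j).
Proof.
intros H; induction H as [|k _ IH]; [apply poset_refl|].
eapply poset_trans; [apply c_decreasing | exact IH].
Qed.

Lemma chain_meet_le (k : nat) : le chain_meet (emb C (c k)).
Proof. apply (Meet_glb C); exists k; reflexivity. Qed.

Lemma chain_meet_closed : closed_elt C chain_meet.
Proof.
exists (fun a => exists k, a = c k); unfold chain_meet; f_equal.
apply ensemble_ext; intros v; split.
- intros (k & ->); apply Im_intro with (c k); [exists k|]; reflexivity.
- intros [a (k & ->) w ->]; exists k; reflexivity.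
Qed.

(** Compactness leaves finitely many members of the chain, and a single member of the chain lies
    below them all. *)
Lemma chain_compact (a : P) :
  le chain_meet (emb C a) -> exists k, le (c k) a.
Proof.
intros H; destruct HC as ((emb_le & _) & _ & comp).
destruct (comp (fun v => exists k, v = emb C (c k)) (Singleton _ (emb C a)))
  as [(A0 & B0 & FA & IA & _ & IB & H0) _].
- intros v (k & ->); apply emb_closed.
- intros v Hv; destruct Hv; apply emb_open.
- eapply poset_trans; [exact H|]; apply (Join_lub C); constructor.
- assert (EA : exists k, forall v, A0 v -> le (emb C (c k)) v).
  { clear H0; induction FA as [|A0 _ IH x _].
    - exists 0; intros v [].
    - destruct IH as (k & Hk); [intros v Hv; apply IA; left; exact Hv|].
      destruct (IA x) as (j & ->); [right; constructor|].
      exists (max j k); intros v [w Hw|w Hw].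
      + eapply poset_trans; [|apply Hk, Hw]; apply emb_le, chain_le; lia.
      + destruct Hw; apply emb_le, chain_le; lia. }
  destruct EA as (k & Hk); exists k; apply emb_le.
  eapply poset_trans; [apply (Meet_glb C A0); exact Hk|].
  eapply poset_trans; [exact H0|]; apply (Join_lub C).
  intros v Hv; destruct (IB v Hv); apply poset_refl.
Qed.

(** Any [a] of [P] above the meet lies above some [c k] by compactness, so [f a] lies above
    [c (S k)] and hence above the meet. *)
Lemma sigma_map_chain_meet (f : P -> P) :
  (forall a b, le a b -> le (f a) (f b)) ->
  (forall k, c (S k) = f (c k)) ->
  le chain_meet (sigma_map C C f chain_meet).
Proof.
intros f_mono c_S; unfold sigma_map.
eapply poset_trans; [|apply (proj1 (Join_lub C _))].
(* The interval from the closed element [chain_meet] to the open element [c 0] contributes to the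
   join. *)
2: { exists chain_meet, (emb C (c 0)).
     split; [exact chain_meet_closed|]; split; [apply emb_open|].
     split; [apply poset_refl|]; split; [apply chain_meet_le | reflexivity]. }
apply (Meet_glb C); intros v (a & Ha & _ & ->).
destruct (chain_compact a Ha) as (k & Hk).
eapply poset_trans; [apply (chain_meet_le (S k))|].
apply (proj1 HC); rewrite c_S; apply f_mono, Hk.
Qed.

End Chains.

(** * Fixpoints of the term *)

Section Fixpoints.
Variables (S : signature) (E : theory S) (L : semilattice_ordered E)
  (t : term S unit).

(** Inequalities are equations, hence preserved by homomorphisms and, in [semilattice_le_reflect],
    reflected by injective ones. *)
Lemma semilattice_le_hom (A B : algebra S) (f : A -> B) (a b : A) :
  homomorphism A B f -> semilattice_le L A a b ->
  semilattice_le L B (f a) (f b).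
Proof.
intros Hf; unfold semilattice_le; destruct (sl_kind L); intros H;
  rewrite <- (hom_binary _ _ _ Hf), H; reflexivity.
Qed.

Lemma semilattice_le_reflect (A B : algebra S) (f : A -> B) (a b : A) :
  homomorphism A B f -> (forall u v, f u = f v -> u = v) ->
  semilattice_le L B (f a) (f b) -> semilattice_le L A a b.
Proof.
intros Hf If; unfold semilattice_le; destruct (sl_kind L); intros H;
  apply If; rewrite (hom_binary _ _ _ Hf), H; reflexivity.
Qed.

Lemma semilattice_order (A : algebra S) :
  in_variety E A -> order A (semilattice_le L A).
Proof.
intros HA; pose proof (sl_assoc L HA) as As; pose proof (sl_comm L HA) as Co;
  pose proof (sl_idem L HA) as Id.
unfold semilattice_le; split; destruct (sl_kind L).
- intros a; apply Id.
- intros a; apply Id.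
- intros a b d H1 H2; rewrite <- H1, <- As, H2; reflexivity.
- intros a b d H1 H2; rewrite <- H2, As, H1; reflexivity.
- intros a b H1 H2; rewrite <- H1, Co; exact H2.
- intros a b H1 H2; rewrite <- H2, Co; exact H1.
Qed.

(** Through this, hypotheses about ordered algebras reach bare members of the variety; the order is
    the one that the semilattice term defines. *)
Lemma ordered_reduct (A : algebra S) : in_variety E A ->
  exists A' : ordered_algebra S, A = A' /\ in_ordered_variety L A'.
Proof.
intros HA; destruct A as [U o].
exists (@OrderedAlgebra S (Poset (semilattice_order HA)) o).
split; [reflexivity|]; split; [exact HA | reflexivity].
Qed.

Hypothesis t_mono : order_preserving L t.
Hypothesis t_decr : decreasing L t.

Lemma unary_mono (A : algebra S) (a b : A) : in_variety E A ->
  semilattice_le L A a b -> semilattice_le L A (unary A t a) (unary A t b).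
Proof.
intros HA; destruct (ordered_reduct HA) as (A' & -> & HA').
intros H; apply HA'; apply (t_mono HA'); apply HA'; exact H.
Qed.

Lemma unary_decreasing (A : algebra S) (a : A) : in_variety E A ->
  semilattice_le L A (unary A t a) a.
Proof.
intros HA; destruct (ordered_reduct HA) as (A' & -> & HA').
apply HA'; apply (t_decr HA').
Qed.

Lemma unary_power_anti (A : algebra S) (a : A) (j k : nat) : in_variety E A ->
  j <= k ->
  semilattice_le L A (unary A (term_power t k) a) (unary A (term_power t j) a).
Proof.
intros HA H; destruct (semilattice_order HA) as [R T _].
induction H as [|k _ IH]; [apply R|].
apply T with (unary A (term_power t k) a); [|exact IH].
rewrite unary_power_S; apply unary_decreasing, HA.
Qed.

(** Monotonicity applied to [x <= t^k(z)] gives [t(x) <= t^(k+1)(z)], and [t(x)] is [x]. *)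
Lemma fixpoint_le_power (A : algebra S) (x z : A) (k : nat) : in_variety E A ->
  unary A t x = x -> semilattice_le L A x z ->
  semilattice_le L A x (unary A (term_power t k) z).
Proof.
intros HA Hx Hz; induction k as [|k IH]; [exact Hz|].
rewrite unary_power_S, <- Hx; apply unary_mono; assumption.
Qed.

Variable ext : forall P : poset, extension P.
Hypothesis ext_canonical : forall P : poset, canonical_extension (ext P).
Hypothesis ext_closed : closed_under_canonical_extensions L ext.
Hypothesis t_exp : expanding L ext t.

(** [B] is the canonical extension and [x] the meet of the [t^k(e)]. The sigma-extension of [t] at
    [x] lies above [x] and, as [t] is expanding, below [t(x)]; and [t(x) <= x] because [B] lies in
    the variety. *)
Lemma fixpoint_embedding (A : algebra S) (d e : A) : in_variety E A ->
  (forall k, semilattice_le L A d (unary A (term_power t k) e)) ->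
  exists (B : algebra S) (f : A -> B) (x : B),
    in_variety E B /\ homomorphism A B f /\ (forall u v, f u = f v -> u = v) /\
    semilattice_le L B (f d) x /\ unary B t x = x /\ semilattice_le L B x (f e).
Proof.
intros HA; destruct (ordered_reduct HA) as (A' & -> & HA'); clear HA.
intros Hd.
assert (HB : in_ordered_variety L (canonical_algebra L A' (ext A')))
  by (apply ext_closed, HA').
assert (emb_le : forall a b : A', le (emb (ext A') a) (emb (ext A') b) <-> le a b)
  by apply ext_canonical.
set (c := fun k => unary A' (term_power t k) e : A').
assert (c_decr : forall k, le (c (Datatypes.S k)) (c k)).
{ intros k; apply HA'; apply unary_power_anti; [apply HA' | auto]. }
set (x := Meet (fun v => exists k, v = emb (ext A') (c k))).
exists (canonical_algebra L A' (ext A')), (emb (ext A')), x.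
split; [apply HB|]; split.
{ intros o a; symmetry.
  exact (operation_extension_emb (ext A') emb_le (sl_ext L o) (oa_op A' o) a). }
split; [apply emb_injective, emb_le|]; split; [|split].
- apply (proj2 HB); apply (Meet_glb (ext A')).
  intros v (k & ->); apply emb_le; apply HA'; apply Hd.
- apply (ord_antisym _ _ (le_order (ext A'))).
  + apply (t_decr HB).
  + apply (@poset_trans (ext A')) with (sigma_map (ext A') (ext A') (unary A' t) x).
    * apply sigma_map_chain_meet; [apply ext_canonical | exact c_decr | |].
      -- exact (t_mono HA').
      -- intros k; exact (unary_power_S A' t k e).
    * apply t_exp, HA'.
(* The member of the chain at index 0 is [t^0(e)], which is [e]. *)
- apply (proj2 HB); exact (chain_meet_le (ext A') c 0).
Qed.

(** * The presented algebra *)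

(** The equation expressing [a <= b]. *)
Definition le_pair (A : algebra S) (a b : A) : A * A :=
  (binary A (sl_term L) a b,
   match sl_kind L with MeetSemilattice => a | JoinSemilattice => b end).

Lemma le_pair_hom (A B : algebra S) (f : A -> B) (a b : A) :
  homomorphism A B f ->
  f (fst (le_pair A a b)) = f (snd (le_pair A a b)) <->
  semilattice_le L B (f a) (f b).
Proof.
intros Hf; unfold le_pair, semilattice_le; simpl.
rewrite (hom_binary _ _ _ Hf); destruct (sl_kind L); reflexivity.
Qed.

Let tm := term_algebra S (Fin.t 3).
Let x0 : tm := Var Fin.F1.
Let y0 : tm := Var (Fin.FS Fin.F1).
Let z0 : tm := Var (Fin.FS (Fin.FS Fin.F1)).

(** Kept as pairs of terms, so that they can be evaluated in any algebra; [free_rels] carries them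
    to the free algebra, as [finitely_presented] requires. *)
Let rels : list (tm * tm) :=
  le_pair tm y0 x0 :: (unary tm t x0, x0) :: le_pair tm x0 z0 :: nil.

Let free_rels : list (free_algebra E (Fin.t 3) * free_algebra E (Fin.t 3)) :=
  map (fun r => (free_class E (fst r), free_class E (snd r))) rels.

Let A0 : algebra S := presented (fun a b => List.In (a, b) free_rels).
Let cl (p : tm) : A0 := presented_class (fun a b => List.In (a, b) free_rels) p.
Let y : A0 := cl y0.
Let z : A0 := cl z0.

Let cl_hom : homomorphism tm A0 cl.
Proof. apply presented_class_hom. Qed.

Let cl_rel (r : tm * tm) : List.In r rels -> cl (fst r) = cl (snd r).
Proof.
intros H; apply presented_class_eq.
apply in_map with (f := fun r => (free_class E (fst r), free_class E (snd r))) in H.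
exact H.
Qed.

Let A0_in_variety : in_variety E A0.
Proof. apply presented_in_variety. Qed.

Let cl_le (p q : tm) : List.In (le_pair tm p q) rels ->
  semilattice_le L A0 (cl p) (cl q).
Proof.
intros H; apply (le_pair_hom _ _ cl_hom), cl_rel, H.
Qed.

(** The fixpoint lies in between: [y <= x <= t^k(z)]. *)
Let y_le_power (k : nat) : semilattice_le L A0 y (unary A0 (term_power t k) z).
Proof.
apply (ord_trans _ _ (semilattice_order A0_in_variety)) with (cl x0).
- apply cl_le; simpl; auto.
- apply fixpoint_le_power; [exact A0_in_variety | |].
  + rewrite <- (hom_unary _ _ cl_hom).
    apply (@cl_rel (unary tm t x0, x0)); simpl; auto.
  + apply cl_le; simpl; auto.
Qed.

(** * Equations between [y] and [z] and their finite causes *)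

Let pair (A : algebra S) (a b : A) : bool -> A :=
  fun i : bool => if i then a else b.

Let pair_hom (A B : algebra S) (f : A -> B) (a b : A) (p : term S bool) :
  homomorphism A B f -> f (eval (pair A a b) p) = eval (pair B (f a) (f b)) p.
Proof. exact (hom_binary p a b). Qed.

(** An embedding of [D] into some [B] supplies a fixpoint between the images of [d] and [e], hence a
    homomorphism from [A0] to [B] that carries the equation there; injectivity brings it back to
    [D]. *)
Let consequence (p q : term S bool) : eval (pair A0 y z) p = eval (pair A0 y z) q ->
  forall (D : algebra S) (d e : D), in_variety E D ->
  (forall k, semilattice_le L D d (unary D (term_power t k) e)) ->
  eval (pair D d e) p = eval (pair D d e) q.
Proof.
intros H D d e HD Hde.
destruct (fixpoint_embedding d e HD Hde) as (B & f & x & HB & Hf & If & Hdx & Hx & Hxe).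
(* The list follows the numbering of the generators; the default [x] of [nth] is never reached, the
   index being below 3. *)
set (h := fun i : Fin.t 3 =>
  nth (proj1_sig (Fin.to_nat i)) (x :: f d :: f e :: nil) x).
destruct (@presented_lift S E (Fin.t 3) (fun a b => List.In (a, b) free_rels)
  B h HB) as (g & Hg & Eg).
{ intros a b Hab; apply in_map_iff in Hab; destruct Hab as ([p' q'] & Epq & Hr).
  injection Epq as <- <-; exists p', q'; split; [reflexivity|]; split; [reflexivity|].
  assert (Hle : forall u v : tm, semilattice_le L B (eval h u) (eval h v) ->
    le_pair tm u v = (p', q') -> eval h p' = eval h q').
  { intros u v Huv Er; apply (le_pair_hom (A := tm) u v (eval_hom _ h)) in Huv.
    rewrite Er in Huv; exact Huv. }
  destruct Hr as [Hr|[Hr|[Hr|[]]]].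
  - apply Hle with y0 x0; [exact Hdx | exact Hr].
  - injection Hr as <- <-; rewrite (hom_unary (A := tm) t x0 (eval_hom _ h)); exact Hx.
  - apply Hle with x0 z0; [exact Hxe | exact Hr]. }
apply If; rewrite !(pair_hom _ _ _ Hf).
change (f d) with (eval h y0); change (f e) with (eval h z0).
rewrite <- !Eg; apply (f_equal g) in H.
rewrite !(pair_hom _ _ _ Hg) in H; exact H.
Qed.

(** The congruence of the algebra presented by two generators and the one relation [y <= t^n(z)],
    described by validity so that it applies directly in every [D]. *)
Let implied (n : nat) : relation (term_algebra S bool) := fun p q =>
  forall (D : algebra S) (d e : D), in_variety E D ->
  semilattice_le L D d (unary D (term_power t n) e) ->
  eval (pair D d e) p = eval (pair D d e) q.

(** The powers of [t] decrease, so a larger exponent gives a stronger premise. *)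
Let implied_mono (m n : nat) p q : m <= n -> implied m p q -> implied n p q.
Proof.
intros Hmn H D d e HD Hde; apply H; [exact HD|].
apply (ord_trans _ _ (semilattice_order HD)) with (unary D (term_power t n) e);
  [exact Hde | apply unary_power_anti; assumption].
Qed.

Let limit : relation (term_algebra S bool) := fun p q => exists n, implied n p q.

(** Each instance of transitivity or compatibility involves finitely many pairs, which share a
    common index. *)
Let limit_congruence : congruence (term_algebra S bool) limit.
Proof.
split; [split|].
- intros p; exists 0; intros D d e _ _; reflexivity.
- intros p q r (m & Hm) (n & Hn); exists (max m n); intros D d e HD Hde.
  transitivity (eval (pair D d e) q);
    [apply (implied_mono (Nat.le_max_l m n) Hm)
    |apply (implied_mono (Nat.le_max_r m n) Hn)]; assumption.
- intros p q (m & Hm); exists m; intros D d e HD Hde; symmetry; apply Hm; assumption.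
- intros o a b H.
  destruct (fin_uniform_bound (fun i n => implied n (a i) (b i))) as (n & Hn).
  + intros i j k; apply implied_mono.
  + exact H.
  + exists n; intros D d e HD Hde; simpl; f_equal; extensionality i.
    apply Hn; assumption.
Qed.

(** Instead of the compactness theorem, [consequence] is applied in the
    quotient by the union of the increasing chain of congruences [implied n]. *)
Let consequence_finite (p q : term S bool) :
  eval (pair A0 y z) p = eval (pair A0 y z) q -> exists n, implied n p q.
Proof.
intros H.
assert (Hlim : exists (D : algebra S) (k : term_algebra S bool -> D),
  in_variety E D /\ homomorphism (term_algebra S bool) D k /\
  forall u v, k u = k v <-> limit u v).
{ exists (quotient (term_algebra S bool) limit), (class _ limit); split; [|split].
  - apply term_quotient_in_variety; [exact limit_congruence|].
    (* Substitution instances of axioms hold in every member of the variety, so any index would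
       do. *)
    intros u v g Huv; exists 0; intros B d e HB _; rewrite !eval_subst.
    apply HB, Huv.
  - apply class_hom, limit_congruence.
  - apply class_eq, limit_congruence. }
destruct Hlim as (D & k & HD & Hk & k_eq).
(* Evaluation at the classes of the two variables is the quotient map itself. *)
assert (Ek : forall r, eval (pair D (k (Var true)) (k (Var false))) r = k r).
{ intros r; rewrite <- (pair_hom _ _ _ Hk); f_equal.
  induction r as [[]|o rs IH]; simpl; f_equal; extensionality i; apply IH. }
apply k_eq; rewrite <- (Ek p), <- (Ek q); apply consequence; [exact H | exact HD |].
(* The equation that expresses [d <= t^n(e)] belongs to [implied n] trivially, so all these
   inequalities hold in the quotient. *)
intros n; rewrite <- (hom_unary _ _ Hk).
apply (le_pair_hom _ _ Hk), k_eq.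
exists n; intros B d e HB Hde; pose proof (eval_hom _ (pair B d e)) as Hev.
apply (le_pair_hom _ _ Hev); rewrite (hom_unary _ _ Hev); exact Hde.
Qed.

(** The largest of the indices serves for all equations. *)
Let consequences_finite (l : list (term S bool * term S bool)) :
  (forall p q, List.In (p, q) l -> eval (pair A0 y z) p = eval (pair A0 y z) q) ->
  exists n, forall p q, List.In (p, q) l -> implied n p q.
Proof.
induction l as [|[p q] l IH]; intros H.
- exists 0; intros p q [].
- destruct IH as (n & Hn); [intros; apply H; right; assumption|].
  destruct (@consequence_finite p q) as (m & Hm); [apply H; left; reflexivity|].
  exists (max m n); intros p' q' [Epq|Hpq].
  + injection Epq as <- <-; apply (implied_mono (Nat.le_max_l m n) Hm).
  + apply (implied_mono (Nat.le_max_r m n) (Hn _ _ Hpq)).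
Qed.

(** A finite presentation of the subalgebra generated by [y] and [z] is translated into finitely
    many equations in [y] and [z], all of which follow from one [d <= t^n(e)]. Hence a homomorphism
    sends [y] and [z] to [d] and [e], and it transports [y <= t^(n+1)(z)]. *)
Lemma coherent_power_le : coherent E ->
  exists n, forall (D : algebra S) (d e : D), in_variety E D ->
    semilattice_le L D d (unary D (term_power t n) e) ->
    semilattice_le L D d (unary D (term_power t (Datatypes.S n)) e).
Proof.
intros coh.
set (G := fun a : A0 => a = y \/ a = z).
set (B := subalgebra A0 G).
destruct (coh A0 A0_in_variety) with (G := G) as (m & l & f & g & Hf & gf & fg).
(* [A0] is finitely presented by construction, through the identity. *)
{ exists 3, free_rels, (fun a => a), (fun a => a).
  split; [intros o a; reflexivity|]; split; reflexivity. }
{ replace G with (Union A0 (Singleton A0 y) (Singleton A0 z)).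
  - apply finite_union; apply finite_singleton.
  - apply ensemble_ext; intros a; split.
    + intros [b Hb|b Hb]; destruct Hb; [left|right]; reflexivity.
    + intros [->| ->]; [left|right]; constructor. }
fold B in f, g, Hf, gf, fg.
set (R := fun a b => List.In (a, b) l) in *.
change (quotient (free_algebra E (Fin.t m)) (generated_congruence _ R))
  with (presented R) in *.
pose proof (hom_inverse g Hf gf fg) as Hg.
set (yB := exist _ y (gen_in A0 G y (or_introl eq_refl)) : B).
set (zB := exist _ z (gen_in A0 G z (or_intror eq_refl)) : B).
(* Terms in the [m] new generators that name [y] and [z]. *)
destruct (presented_class_surjective (f yB)) as (wy & Hwy).
destruct (presented_class_surjective (f zB)) as (wz & Hwz).
set (v := fun p => proj1_sig (g (presented_class R p)) : A0).
assert (Hv : homomorphism (term_algebra S (Fin.t m)) A0 v).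
{ intros o a; unfold v; rewrite (presented_class_hom R), Hg; reflexivity. }
(* Conversely, each new generator is the value of a term in [y] and [z]. *)
destruct (ClassicalEpsilon.choice (fun (i : Fin.t m) (s : term S bool) =>
  eval (pair A0 y z) s = v (Var i))) as (s & Hs).
{ intros i; apply generated_pair; exact (proj2_sig (g _)). }
(* Both sides are homomorphic in [p] and agree on the variables. *)
assert (Hsv : forall p, eval (pair A0 y z) (subst s p) = v p).
{ intros p; rewrite eval_subst.
  replace (fun i => eval (pair A0 y z) (s i)) with (fun i => v (Var i))
    by (extensionality i; symmetry; apply Hs).
  rewrite <- (hom_eval (A := term_algebra S (Fin.t m)) Var p Hv); f_equal.
  induction p as [i|o ps IH]; simpl; [reflexivity|].
  f_equal; extensionality i; apply IH. }
set (reps := fun r : free_algebra E (Fin.t m) * free_algebra E (Fin.t m) =>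
  (subst s (repr (fst r)), subst s (repr (snd r)))).
(* The first two equations say that the round trip through the presentation fixes [y] and [z]; the
   others translate its relations. *)
set (eqs := (Var true, subst s wy) :: (Var false, subst s wz) :: map reps l).
destruct (@consequences_finite eqs) as (n & Hn).
{ intros p q [Epq|[Epq|Hpq]].
  - injection Epq as <- <-; rewrite Hsv; unfold v; rewrite Hwy, gf; reflexivity.
  - injection Epq as <- <-; rewrite Hsv; unfold v; rewrite Hwz, gf; reflexivity.
  - apply in_map_iff in Hpq; destruct Hpq as ([a b] & Epq & Hab).
    injection Epq as <- <-; rewrite !Hsv; unfold v; do 2 f_equal.
    apply presented_class_eq; unfold free_class; simpl; rewrite !class_repr; exact Hab. }
exists n; intros D d e HD Hde.
assert (Hn' : forall p q, List.In (p, q) eqs ->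
  eval (pair D d e) p = eval (pair D d e) q)
  by (intros p q Hpq; apply (Hn p q Hpq D d e HD Hde)).
(* The relations hold in [D] at the values of the terms [s i], so these values define a homomorphism
   from the presented algebra. *)
destruct (@presented_lift S E (Fin.t m) R D (fun i => eval (pair D d e) (s i)) HD)
  as (k & Hk & Ek).
{ intros a b Hab; exists (repr a), (repr b).
  split; [symmetry; apply class_repr|]; split; [symmetry; apply class_repr|].
  rewrite <- !eval_subst; apply Hn'; right; right.
  exact (in_map reps l (a, b) Hab). }
pose proof (hom_comp Hf Hk) as Hkf.
assert (Ed : k (f yB) = d).
{ rewrite <- Hwy, Ek, <- eval_subst; symmetry; apply (Hn' (Var true)); left; reflexivity. }
assert (Ee : k (f zB) = e).
{ rewrite <- Hwz, Ek, <- eval_subst; symmetry; apply (Hn' (Var false)).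
  right; left; reflexivity. }
(* It suffices to have the inequality in the subalgebra, and thus in [A0], since the inclusion is
   injective. *)
rewrite <- Ed, <- Ee, <- (hom_unary (A := B) _ _ Hkf).
apply (semilattice_le_hom (A := B) _ _ Hkf).
apply (semilattice_le_reflect (A := B) yB _ (@proj1_sig_hom S A0 G)).
{ intros a b Hab; apply eq_sig_hprop; [intros; apply proof_irrelevance | exact Hab]. }
rewrite (hom_unary _ _ (@proj1_sig_hom S A0 G)); apply y_le_power.
Qed.

End Fixpoints.

Theorem theorem5p1 (S : signature) (E : theory S) (L : semilattice_ordered E)
  (ext : forall P : poset, extension P)
  (ext_canonical : forall P : poset, canonical_extension (ext P))
  (t : term S unit) :
  has_constant S ->
  coherent E ->
  closed_under_canonical_extensions L ext ->
  expanding L ext t ->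
  order_preserving L t ->
  decreasing L t ->
  exists n : nat, potent E t n.
Proof.
intros _ coh closed t_exp t_mono t_decr.
destruct (coherent_power_le t_mono t_decr ext_canonical closed t_exp coh)
  as (n & Hn).
exists n; intros A HA h; rewrite Nat.add_1_r.
(* A valuation of the only variable is constant, which is the form that [unary] uses. *)
replace h with (fun _ : unit => h tt) by (extensionality u; destruct u; reflexivity).
apply (ord_antisym _ _ (semilattice_order L HA)).
- apply (unary_power_anti t_decr (h tt) HA (Nat.le_succ_diag_r n)).
(* With [d = t^n(a)] and [e = a], the premise is reflexivity. *)
- apply (Hn A (unary A (term_power t n) (h tt)) (h tt) HA).
  apply (ord_refl _ _ (semilattice_order L HA)).
Qed.
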